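(* Let $G$ be a group, let $R$ be a $G$-graded commutative ring with nonzero unity, let $M$ be a $G$-graded unitary $R$-module, and let $\phi: GS(M)\rightarrow GS(M)\cup\{\emptyset\}$ be a function with $\phi(L)\subseteq L$ for all $L\in GS(M)$. Let $K$ be a graded $R$-submodule of $M$. If $N$ is a graded $\phi$-prime $R$-submodule of $M$ and $K\subseteq N$, then $N/K$ is a graded $\phi_K$-prime $R$-submodule of $M/K$.
   Context: $R=\bigoplus_{h\in G}R_h$ is a $G$-graded commutative ring with nonzero unity $1$ ($R_h$ additive subgroups, $R_hR_k\subseteq R_{hk}$), and $M=\bigoplus_{h\in G}M_h$ is a $G$-graded unitary $R$-module ($M_h$ additive subgroups, $R_hM_k\subseteq M_{hk}$). The sets of homogeneous elements are $h(R)=\bigcup_{k\in G}R_k$ and $h(M)=\bigcup_{k\in G}M_k$. An $R$-submodule $L$ of $M$ is graded if $L=\bigoplus_{k\in G}(L\cap M_k)$. $GS(M)$ is the set of all graded $R$-submodules of $M$. $(L:_RM)=\{r\in R: rM\subseteq L\}$. For a graded $R$-module $M$ and a function $\phi: GS(M)\to GS(M)\cup\{\emptyset\}$, a proper graded $R$-submodule $L$ of $M$ is a graded $\phi$-prime $R$-submodule of $M$ if whenever $r\in h(R)$ and $m\in h(M)$ satisfy $rm\in L-\phi(L)$ (set difference), then $m\in L$ or $r\in(L:_RM)$. For a graded $R$-submodule $K$ of $M$, $M/K$ is a $G$-graded $R$-module with $(M/K)_k=(M_k+K)/K$ for all $k\in G$. The graded submodules of $M/K$ are the $N/K$ with $N\in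 GS(M)$, $N\supseteq K$. The function $\phi_K: GS(M/K)\to GS(M/K)\cup\{\emptyset\}$ is defined, for $N\in GS(M)$ with $N\supseteq K$, by $\phi_K(N/K)=(\phi(N)+K)/K$ if $\phi(N)\neq\emptyset$, and $\phi_K(N/K)=\emptyset$ if $\phi(N)=\emptyset$. *)

(* Defs.v *)
From HB Require Import structures.
From mathcomp Require Import all_boot all_order all_algebra.
From mathcomp Require Import generic_quotient ring_quotient.
From mathcomp Require Import boolp classical_sets functions cardinality fsbigop.

Set Implicit Arguments.
Unset Strict Implicit.
Unset Printing Implicit Defensive.

Import GRing.Theory.
Local Open Scope classical_set_scope.
Local Open Scope ring_scope.
Local Open Scope quotient_scope.

(* [\sum_(i \in A) f i] is 0 by convention when f has infinite support in A,
   hence the explicit finiteness clause. *)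
Definition decomposes (I : choiceType) (V : zmodType) (A : I -> set V)
    (x : V) (f : I -> V) : Prop :=
  [/\ forall i, A i (f i), finite_set [set i | f i != 0] &
      x = \sum_(i \in [set: I]) f i].

Definition is_direct_sum (I : choiceType) (V : zmodType) (A : I -> set V)
    (B : set V) : Prop :=
  (forall i, A i `<=` B) /\ (forall x, B x -> exists! f, decomposes A x f).

Definition additive_subgroup (V : zmodType) (A : set V) : Prop :=
  GRing.zmod_closed (mem A).

Record gradedRing (G : groupType) := GradedRing {
  gring_sort :> comNzRingType;
  gring_comp : G -> set gring_sort;
  gring_subgroup : forall h, additive_subgroup (gring_comp h);
  gring_direct_sum : is_direct_sum gring_comp [set: gring_sort];
  gring_mul : forall h k r s, gring_comp h r -> gring_comp k s ->
    gring_comp (h * k)%g (r * s) }.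

Record gradedModule (G : groupType) (R : gradedRing G) := GradedModule {
  gmod_sort :> lmodType R;
  gmod_comp : G -> set gmod_sort;
  gmod_subgroup : forall h, additive_subgroup (gmod_comp h);
  gmod_direct_sum : is_direct_sum gmod_comp [set: gmod_sort];
  gmod_scale : forall h k r m, gring_comp h r -> gmod_comp k m ->
    gmod_comp (h * k)%g (r *: m) }.

Definition homogeneous_ring (G : groupType) (R : gradedRing G) : set R :=
  \bigcup_k gring_comp (g := R) k.

Definition homogeneous_mod (G : groupType) (R : gradedRing G)
    (M : gradedModule R) : set M :=
  \bigcup_k gmod_comp (g := M) k.

Record gradedSubmodule (G : groupType) (R : gradedRing G)
    (M : gradedModule R) := GradedSubmodule {
  gsub_set :> set M;
  gsub_submod : GRing.submod_closed (mem gsub_set);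
  gsub_graded : is_direct_sum (fun k => gsub_set `&` gmod_comp k) gsub_set }.

(* [option (gradedSubmodule M)] encodes GS(M) together with the empty set,
   the latter being represented by [None]. *)
Definition opt_set (G : groupType) (R : gradedRing G) (M : gradedModule R)
    (oL : option (gradedSubmodule M)) : set M :=
  if oL is Some L then gsub_set L else set0.

Definition colon (G : groupType) (R : gradedRing G) (M : gradedModule R)
    (L : gradedSubmodule M) : set R :=
  [set r | forall m : M, gsub_set L (r *: m)].

Definition graded_phi_prime (G : groupType) (R : gradedRing G)
    (M : gradedModule R)
    (phi : gradedSubmodule M -> option (gradedSubmodule M))
    (L : gradedSubmodule M) : Prop :=
  gsub_set L <> [set: M] /\
  forall (r : R) (m : M), homogeneous_ring r -> homogeneous_mod m ->
    (L `\` opt_set (phi L)) (r *: m) -> gsub_set L m \/ colon L r.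

Section FiniteSums.
Variables (I : choiceType).

Lemma fsum_fin (V : zmodType) (f : I -> V) (D : set I) : finite_set D ->
  [set i | f i != 0] `<=` D ->
  \sum_(i \in [set: I]) f i = \sum_(i <- finmap.enum_fset (fset_set D)) f i.
Proof.
move=> finD sD; rewrite -fsbig_finite //; apply/esym/fsbig_widen => //.
move=> i [_ /= nDi]; apply/eqP; apply: contrapT => /negP fi.
exact/nDi/sD.
Qed.

Lemma fin_suppD (V : zmodType) (f g : I -> V) :
  finite_set [set i | f i != 0] -> finite_set [set i | g i != 0] ->
  finite_set [set i | f i + g i != 0].
Proof.
move=> ff gf; apply: (@sub_finite_set _ _ ([set i | f i != 0] `|` [set i | g i != 0])).
  move=> i /= h; have [f0|?] := eqVneq (f i) 0; last by left.
  by right; rewrite f0 add0r in h.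
by rewrite finite_setU.
Qed.

Lemma fin_supp_raddf (V W : zmodType) (u : {additive V -> W}) (f : I -> V) :
  finite_set [set i | f i != 0] -> finite_set [set i | u (f i) != 0].
Proof.
apply: sub_finite_set => i /=; apply: contra_neq => ->; exact: raddf0.
Qed.

Lemma fsumD (V : zmodType) (f g : I -> V) :
  finite_set [set i | f i != 0] -> finite_set [set i | g i != 0] ->
  \sum_(i \in [set: I]) (f i + g i)
  = \sum_(i \in [set: I]) f i + \sum_(i \in [set: I]) g i.
Proof.
move=> ff gf; set D := [set i | f i != 0] `|` [set i | g i != 0].
have finD : finite_set D by rewrite finite_setU.
rewrite !(@fsum_fin _ _ D) ?big_split//; first by move=> i; right.
  by move=> i; left.
move=> i /= h; have [f0|?] := eqVneq (f i) 0; last by left.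
by right; rewrite f0 add0r in h.
Qed.

Lemma raddf_fsum (V W : zmodType) (u : {additive V -> W}) (f : I -> V) :
  finite_set [set i | f i != 0] ->
  u (\sum_(i \in [set: I]) f i) = \sum_(i \in [set: I]) u (f i).
Proof.
move=> ff; rewrite (@fsum_fin _ f [set i | f i != 0])//.
rewrite (@fsum_fin _ (u \o f) [set i | f i != 0]) ?raddf_sum//.
by move=> i /=; apply: contra_neq => ->; exact: raddf0.
Qed.

Lemma fsum_in (V : zmodType) (B : set V) (f : I -> V) :
  additive_subgroup B -> finite_set [set i | f i != 0] ->
  (forall i, B (f i)) -> B (\sum_(i \in [set: I]) f i).
Proof.
move=> [B0 BB] ff Bf; rewrite (@fsum_fin _ f [set i | f i != 0])//.
have B0' : B 0 by move: B0; rewrite !inE.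
elim/big_ind: _ => // x y Bx By.
have BN : B (- y) by have := BB _ _ (mem_set B0') (mem_set By); rewrite sub0r !inE.
by have := BB _ _ (mem_set Bx) (mem_set BN); rewrite opprK inE.
Qed.

End FiniteSums.

(* The quotient of a module by a submodule: ring_quotient provides the
   additive group structure of [Quotient.quot S]; the scaling is added here. *)

Section LmodQuotient.
Variables (R : pzRingType) (V : lmodType R) (S : {pred V})
  (S_closed : GRing.submod_closed S).

Definition lmod_zmodClosed : zmodClosed V :=
  HB.pack S (GRing.isZmodClosed.Build V S (GRing.submod_closedB S_closed)).

Definition lmod_quot : Type := Quotient.quot lmod_zmodClosed.
HB.instance Definition _ := GRing.Zmodule.on lmod_quot.

Definition lmod_proj (x : V) : lmod_quot := \pi_(Quotient.quot lmod_zmodClosed) x.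

Definition lmod_repr (q : lmod_quot) : V := repr (q : Quotient.quot lmod_zmodClosed).

Lemma lmod_reprK : cancel lmod_repr lmod_proj.
Proof. exact: reprK. Qed.

Lemma lmod_proj_eq x y : (lmod_proj x = lmod_proj y) <-> (x - y \in S).
Proof.
rewrite (Quotient.idealrBE lmod_zmodClosed); split => [h|/eqP h]; last exact: h.
by apply/eqP; exact: h.
Qed.

Lemma lmod_proj_zmod : zmod_morphism lmod_proj.
Proof. exact: (@pi_is_zmod_morphism V _ _ (Quotient.quot lmod_zmodClosed)). Qed.

HB.instance Definition _ :=
  GRing.isZmodMorphism.Build V lmod_quot lmod_proj lmod_proj_zmod.

Definition lmod_quot_scale (a : R) (q : lmod_quot) : lmod_quot :=
  lmod_proj (a *: lmod_repr q).

Lemma lmod_quot_scaleE a x : lmod_quot_scale a (lmod_proj x) = lmod_proj (a *: x).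
Proof.
apply/lmod_proj_eq; rewrite -scalerBr.
have [_ SZ] := GRing.submod_closed_semi S_closed; apply: SZ.
by apply/lmod_proj_eq; exact: lmod_reprK.
Qed.

Lemma lmod_quot_scaleA a b q :
  lmod_quot_scale a (lmod_quot_scale b q) = lmod_quot_scale (a * b) q.
Proof. by rewrite -(lmod_reprK q) !lmod_quot_scaleE scalerA. Qed.

Lemma lmod_quot_scale1 : left_id 1 lmod_quot_scale.
Proof. by move=> q; rewrite -(lmod_reprK q) lmod_quot_scaleE scale1r. Qed.

Lemma lmod_quot_scaleDr : right_distributive lmod_quot_scale +%R.
Proof.
move=> a p q; rewrite -(lmod_reprK p) -(lmod_reprK q) -raddfD.
by rewrite !lmod_quot_scaleE scalerDr raddfD.
Qed.

Lemma lmod_quot_scaleDl q : {morph lmod_quot_scale^~ q : a b / a + b}.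
Proof.
move=> a b /=; rewrite -(lmod_reprK q).
by rewrite !lmod_quot_scaleE scalerDl raddfD.
Qed.

HB.instance Definition _ := GRing.Zmodule_isLmodule.Build R lmod_quot
  lmod_quot_scaleA lmod_quot_scale1 lmod_quot_scaleDr lmod_quot_scaleDl.

Lemma lmod_proj_scalable : scalable lmod_proj.
Proof. by move=> a x; rewrite -lmod_quot_scaleE. Qed.

HB.instance Definition _ :=
  GRing.isScalable.Build R V lmod_quot *:%R lmod_proj lmod_proj_scalable.

End LmodQuotient.

Section GradedQuotient.
Variables (G : groupType) (R : gradedRing G) (M : gradedModule R).
Implicit Types (K L N P : gradedSubmodule M).

Lemma gsub_ext L N : gsub_set L = gsub_set N -> L = N.
Proof.
case: L N => [L l1 l2] [N n1 n2] /= E; subst N.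
by rewrite (Prop_irrelevance l1 n1) (Prop_irrelevance l2 n2).
Qed.

Lemma gsub0 L : gsub_set L 0.
Proof. by have [] := gsub_submod L; rewrite inE. Qed.

Lemma gsubZD L a x y : gsub_set L x -> gsub_set L y -> gsub_set L (a *: x + y).
Proof.
have [_ h] := gsub_submod L => Lx Ly.
by have := h a _ _ (mem_set Lx) (mem_set Ly); rewrite inE.
Qed.

Lemma gsubD L x y : gsub_set L x -> gsub_set L y -> gsub_set L (x + y).
Proof. by move=> Lx Ly; rewrite -(scale1r x); exact: gsubZD. Qed.

Lemma gsubZ L a x : gsub_set L x -> gsub_set L (a *: x).
Proof. by move=> Lx; rewrite -[_ *: _]addr0; apply: gsubZD => //; exact: gsub0. Qed.

Lemma gsubB L x y : gsub_set L x -> gsub_set L y -> gsub_set L (x - y).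
Proof. by move=> Lx Ly; rewrite -scaleN1r addrC; exact: gsubZD. Qed.

Lemma gsub_subgroup L : additive_subgroup L.
Proof.
split; first by rewrite inE; exact: gsub0.
by move=> x y; rewrite !inE; exact: gsubB.
Qed.

Lemma gmod_comp0 k : gmod_comp k (0 : M).
Proof. by have [] := @gmod_subgroup _ _ M k; rewrite inE. Qed.

Lemma gmod_compB k (x y : M) :
  gmod_comp k x -> gmod_comp k y -> gmod_comp k (x - y).
Proof.
have [_ h] := @gmod_subgroup _ _ M k => Lx Ly.
by have := h _ _ (mem_set Lx) (mem_set Ly); rewrite inE.
Qed.

Lemma gmod_compD k (x y : M) :
  gmod_comp k x -> gmod_comp k y -> gmod_comp k (x + y).
Proof.
move=> Lx Ly; rewrite -[y]opprK; apply: gmod_compB => //.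
by rewrite -sub0r; apply: gmod_compB => //; exact: gmod_comp0.
Qed.

Definition gsub_pred K : {pred M} := [pred x | x \in gsub_set K].

Lemma gsub_pred_closed K : GRing.submod_closed (gsub_pred K).
Proof.
split; first by rewrite !inE; exact: gsub0.
by move=> a x y; rewrite !inE; exact: gsubZD.
Qed.

Definition gquot_lmod K : lmodType R := lmod_quot (gsub_pred_closed K).

Definition gproj K : {linear M -> gquot_lmod K} :=
  [the {linear _ -> _} of lmod_proj (gsub_pred_closed K)].

Lemma gproj_eq K x y : (gproj K x = gproj K y) <-> gsub_set K (x - y).
Proof.
by split=> [/lmod_proj_eq|h]; [|apply/lmod_proj_eq]; rewrite !inE.
Qed.

Lemma gproj_eq0 K x : (gproj K x = 0) <-> gsub_set K x.
Proof. by rewrite -(raddf0 (gproj K)) gproj_eq subr0. Qed.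

Lemma gproj_surj K q : exists x, gproj K x = q.
Proof. by exists (lmod_repr q); exact: lmod_reprK. Qed.

Definition gquot_comp K (k : G) : set (gquot_lmod K) :=
  gproj K @` gmod_comp (g := M) k.

Lemma gquot_comp_subgroup K k : additive_subgroup (@gquot_comp K k).
Proof.
split.
  by rewrite inE; exists 0; [exact: gmod_comp0|exact: raddf0].
move=> _ _ /set_mem[x xk <-] /set_mem[y yk <-]; rewrite inE.
by exists (x - y); [exact: gmod_compB|exact: raddfB].
Qed.

Lemma gsub_sum_comp L (f : G -> M) :
  (forall k, gmod_comp k (f k)) -> finite_set [set k | f k != 0] ->
  gsub_set L (\sum_(k \in [set: G]) f k) -> forall k, gsub_set L (f k).
Proof.
move=> fk ff Ls k.
have [_ /(_ _ Ls)[g [[gP gf gE] _]]] := gsub_graded L.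
have [_ /(_ (\sum_(k \in [set: G]) f k) I)[u [_ uU]]] := gmod_direct_sum M.
have uf : u = f by exact: (uU f).
have ug : u = g by apply: (uU g); split => // i; have [] := gP i.
by rewrite -uf ug; have [] := gP k.
Qed.

(* Uniqueness of decompositions in M/K comes from K being graded. *)
Lemma gquot_decomp_uniq K x (f g : G -> gquot_lmod K) :
  decomposes (@gquot_comp K) x f -> decomposes (@gquot_comp K) x g -> f = g.
Proof.
have lift (h : G -> gquot_lmod K) : decomposes (@gquot_comp K) x h ->
    exists h' : G -> M, [/\ forall k, gmod_comp k (h' k),
      finite_set [set k | h' k != 0] & h = gproj K \o h'].
  move=> [hP hf _].
  have /choice[h' h'P] : forall k, exists m : M,
      [/\ gmod_comp k m, gproj K m = h k & h k = 0 -> m = 0].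
    move=> k; have [h0|h0] := eqVneq (h k) 0.
      by exists 0; split=> //; [exact: gmod_comp0|rewrite raddf0].
    have [m mk mE] := hP k; exists m; split => // h0'.
    by rewrite h0' eqxx in h0.
  exists h'; split; first by move=> k; have [] := h'P k.
    apply: sub_finite_set hf => k /=; apply: contra_neq => h0.
    by have [_ _] := h'P k; exact.
  by apply/funext => k /=; have [] := h'P k.
move=> fD gD.
have [f' [f'k f'f fE]] := lift _ fD; have [g' [g'k g'f gE]] := lift _ gD.
have [_ _ xf] := fD; have [_ _ xg] := gD.
have Ng'f : finite_set [set k | - g' k != 0].
  by apply: sub_finite_set g'f => k /=; rewrite oppr_eq0.
have Ksum : gsub_set K (\sum_(k \in [set: G]) (f' k - g' k)).
  apply/gproj_eq0; rewrite raddf_fsum; last exact: fin_suppD.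
  transitivity (\sum_(k \in [set: G]) (f k + - g k)).
    by apply: eq_fsbigr => k _; rewrite raddfB fE gE.
  have [_ ff _] := fD; have [_ gf _] := gD.
  have Ngf : finite_set [set k | - g k != 0].
    by apply: sub_finite_set gf => k /=; rewrite oppr_eq0.
  rewrite fsumD// -xf.
  have -> : \sum_(k \in [set: G]) - g k = - x.
    by rewrite xg (raddf_fsum -%R gf).
  by rewrite subrr.
have Kk := gsub_sum_comp (fun k => gmod_compB (f'k k) (g'k k))
  (fin_suppD f'f Ng'f) Ksum.
by rewrite fE gE; apply/funext => k /=; apply/gproj_eq.
Qed.

Lemma gquot_image_graded K (L : gradedSubmodule M) :
  is_direct_sum (fun k => (gproj K @` L) `&` @gquot_comp K k) (gproj K @` L).
Proof.
split; first by move=> k x [].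
move=> _ [m Lm <-].
have [_ /(_ _ Lm)[f [[fP ff fE] _]]] := gsub_graded L.
exists (gproj K \o f); split.
  split.
  - by move=> k; have [? ?] := fP k; split; exists (f k).
  - exact: fin_supp_raddf.
  - by rewrite fE raddf_fsum.
move=> g [gP gf gE]; apply: (@gquot_decomp_uniq K (gproj K m)); split=> //.
- by move=> k; have [? ?] := fP k; exists (f k).
- exact: fin_supp_raddf.
- by rewrite fE raddf_fsum.
- by move=> k; have [] := gP k.
Qed.

Lemma gquot_direct_sum K : is_direct_sum (@gquot_comp K) [set: gquot_lmod K].
Proof.
split=> // q _; have [m <-] := gproj_surj q.
have [_ /(_ m I)[f [[fP ff fE] _]]] := gmod_direct_sum M.
have fD : decomposes (@gquot_comp K) (gproj K m) (gproj K \o f).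
  split.
  - by move=> k; exists (f k).
  - exact: fin_supp_raddf.
  - by rewrite fE raddf_fsum.
by exists (gproj K \o f); split=> // g; exact: gquot_decomp_uniq.
Qed.

Lemma gquot_scale K h k (r : R) (q : gquot_lmod K) :
  gring_comp h r -> @gquot_comp K k q -> @gquot_comp K (h * k)%g (r *: q).
Proof.
move=> rh [m mk <-]; exists (r *: m); first exact: gmod_scale.
by rewrite linearZ.
Qed.

Definition gquot K : gradedModule R :=
  GradedModule (@gquot_comp_subgroup K) (@gquot_direct_sum K) (@gquot_scale K).

Lemma gquot_sub_submod K N :
  GRing.submod_closed (mem (gproj K @` N : set (gquot K))).
Proof.
split; first by rewrite inE; exists 0; [exact: gsub0|exact: raddf0].
move=> a _ _ /set_mem[x xk <-] /set_mem[y yk <-]; rewrite inE.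
by exists (a *: x + y); [exact: gsubZD|rewrite linearP].
Qed.

(* The image of N in M/K: this is N/K when N contains K, which is the only
   intended use (it is (N + K)/K for an arbitrary N). *)
Definition gquot_sub K N : gradedSubmodule (gquot K) :=
  @GradedSubmodule G R (gquot K) (gproj K @` N)
    (gquot_sub_submod K N) (gquot_image_graded K N).

Definition sum_set P K : set M :=
  [set x | exists p k, [/\ gsub_set P p, gsub_set K k & x = p + k]].

Lemma gsub_add_submod P K : GRing.submod_closed (mem (sum_set P K)).
Proof.
split; first by rewrite inE; exists 0, 0; split; rewrite ?addr0//; exact: gsub0.
move=> a _ _ /set_mem[p [k [Pp Kk ->]]] /set_mem[p' [k' [Pp' Kk' ->]]].
rewrite inE; exists (a *: p + p'), (a *: k + k').
by split; [exact: gsubZD|exact: gsubZD|rewrite scalerDr addrACA].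
Qed.

Lemma gsub_add_graded P K :
  is_direct_sum (fun k => sum_set P K `&` gmod_comp k) (sum_set P K).
Proof.
split; first by move=> k x [].
move=> x [p [q [Pp Kq xE]]].
have [_ /(_ _ Pp)[f [[fP ff fE] _]]] := gsub_graded P.
have [_ /(_ _ Kq)[g [[gP gf gE] _]]] := gsub_graded K.
have dfg : decomposes (fun k => sum_set P K `&` gmod_comp k) x (fun k => f k + g k).
  split.
  - move=> k; have [? ?] := fP k; have [? ?] := gP k.
    by split; [exists (f k), (g k)|exact: gmod_compD].
  - exact: fin_suppD.
  - by rewrite fsumD// -fE -gE.
exists (fun k => f k + g k); split=> // h [hP hf hE].
have [_ /(_ x I)[u [_ uU]]] := gmod_direct_sum M.
have <- : u = h by apply: uU; split=> // k; have [] := hP k.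
by apply/esym/uU; have [d1 d2 d3] := dfg; split=> // k; have [] := d1 k.
Qed.

Definition gsub_add P K : gradedSubmodule M :=
  GradedSubmodule (gsub_add_submod P K) (gsub_add_graded P K).

End GradedQuotient.

Section QuotientPhi.
Variables (G : groupType) (R : gradedRing G) (M : gradedModule R).
Implicit Types (K L N P : gradedSubmodule M).

Lemma gsub_preim_submod K (Q : set (gquot_lmod K)) :
  GRing.submod_closed (mem Q) -> GRing.submod_closed (mem (gproj K @^-1` Q)).
Proof.
move=> [Q0 QP]; split.
  by move: Q0; rewrite !inE /= raddf0.
move=> a x y /set_mem Qx /set_mem Qy; rewrite inE /= linearP.
by have := QP a _ _ (mem_set Qx) (mem_set Qy); rewrite inE.
Qed.

Lemma gsub_preim_graded K (Q : gradedSubmodule (gquot K)) :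
  is_direct_sum (fun k => (gproj K @^-1` Q) `&` gmod_comp k) (gproj K @^-1` Q).
Proof.
split; first by move=> k x [].
move=> x Qx.
have [_ /(_ _ Qx)[u [[uP uf uE] _]]] := gsub_graded Q.
have [_ /(_ x I)[f [[fP ff fE] fU]]] := gmod_direct_sum M.
have ufE : u = gproj K \o f.
  apply: (@gquot_decomp_uniq _ _ _ K (gproj K x)); split=> //.
  - by move=> k; have [] := uP k.
  - by move=> k; exists (f k).
  - exact: fin_supp_raddf.
  - by rewrite fE raddf_fsum.
exists f; split.
  split=> // k; split=> //=.
  by have [] := uP k; rewrite ufE.
by move=> g [gP gf gE]; apply: fU; split=> // k; have [] := gP k.
Qed.

Definition gsub_preim K (Q : gradedSubmodule (gquot K)) : gradedSubmodule M :=
  GradedSubmodule (gsub_preim_submod (gsub_submod Q)) (gsub_preim_graded Q).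

Lemma sub_gsub_preim K (Q : gradedSubmodule (gquot K)) : K `<=` gsub_preim Q.
Proof. by move=> x /gproj_eq0 /= ->; exact: gsub0. Qed.

Lemma gsub_preimK K (Q : gradedSubmodule (gquot K)) :
  gquot_sub K (gsub_preim Q) = Q.
Proof.
apply: gsub_ext => /=; apply/seteqP; split=> [_ [x Qx <-]//|q Qq].
by have [x xE] := gproj_surj q; exists x => //=; rewrite xE.
Qed.

Lemma gquot_subK K N : K `<=` N -> gsub_preim (gquot_sub K N) = N.
Proof.
move=> KN; apply: gsub_ext => /=; apply/seteqP; split=> [x [y Ny xy]|x Nx].
  rewrite -(subrK y x); apply: gsubD => //; apply: KN.
  exact/gproj_eq.
by exists x.
Qed.

(* Every graded submodule Q of M/K is N/K for exactly one N containing K, namely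
   [gsub_preim Q]; [phi_quotE] restates the definition on N/K. *)
Definition phi_quot K (phi : gradedSubmodule M -> option (gradedSubmodule M))
    (Q : gradedSubmodule (gquot K)) : option (gradedSubmodule (gquot K)) :=
  if phi (gsub_preim Q) is Some P then Some (gquot_sub K (gsub_add P K))
  else None.

Lemma phi_quotE K phi N : K `<=` N ->
  @phi_quot K phi (gquot_sub K N)
  = omap (fun P => gquot_sub K (gsub_add P K)) (phi N).
Proof. by move=> KN; rewrite /phi_quot gquot_subK//; case: (phi N). Qed.

End QuotientPhi.

Arguments phi_quot {G R M} K phi Q.

(* Main.v *)
Require Import Defs.
From mathcomp Require Import all_boot all_order all_algebra.
From mathcomp Require Import boolp classical_sets.

Local Open Scope classical_set_scope.

(** Since [K] lies in [N], membership in [N/K] pulls back exactly to membership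
    in [N] ([gquot_sub_projE]), and [M -> M/K] is onto, also from the degree-[k]
    part of [M] to that of [M/K].  So properness and both alternatives of
    primeness can be tested on representatives in [M].  For the excluded set one
    inclusion is enough: [phi N] maps into [(phi N + K)/K], hence a product that
    avoids the latter in [M/K] comes from a product that avoids [phi N] in [M]
    ([phi_quot_proj]), and primeness of [N] applies to it. *)

(** Two representatives of a class modulo [K] differ by an element of [K], hence
    of [N]; so [N] is the full preimage of its image in [M/K]. *)
Lemma gquot_sub_projE (G : groupType) (R : gradedRing G) (M : gradedModule R)
    (K N : gradedSubmodule M) (KN : gsub_set K `<=` gsub_set N) (x : M) :
  gsub_set (gquot_sub K N) (gproj K x) <-> gsub_set N x.
Proof. by rewrite -{2}(gquot_subK KN). Qed.

(** This is used contrapositively: it sends a product outside the excluded set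
    of [N/K] to one outside [phi N].  When [phi N] is empty there is nothing to
    exclude on either side. *)
Lemma phi_quot_proj (G : groupType) (R : gradedRing G) (M : gradedModule R)
    (phi : gradedSubmodule M -> option (gradedSubmodule M))
    (K N : gradedSubmodule M) (x : M) :
  gsub_set K `<=` gsub_set N ->
  opt_set (phi N) x -> opt_set (phi_quot K phi (gquot_sub K N)) (gproj K x).
Proof.
move=> KN; rewrite phi_quotE//; case: (phi N) => //= P Px.
exists x => //; exists x, 0%R; split=> //; first exact: gsub0.
by rewrite GRing.addr0.
Qed.

Theorem theorem2p10 (G : groupType) (R : gradedRing G) (M : gradedModule R)
    (phi : gradedSubmodule M -> option (gradedSubmodule M))
    (phi_sub : forall L : gradedSubmodule M, opt_set (phi L) `<=` gsub_set L)
    (K N : gradedSubmodule M)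
    (N_prime : graded_phi_prime phi N)
    (KN : gsub_set K `<=` gsub_set N) :
  graded_phi_prime (phi_quot K phi) (gquot_sub K N).
Proof.
have [N_proper primeN] := N_prime.
have NKE := gquot_sub_projE _ _ _ _ _ KN.
split.
  move=> NK_full; apply: N_proper; apply/seteqP; split=> // x _.
  by apply/(NKE); rewrite NK_full.
move=> r q r_hom [k _ [m mk <-]].
rewrite -GRing.linearZ => -[/(NKE) Nrm nphi_rm].
have m_hom : homogeneous_mod m by exists k.
have rm_notin : (gsub_set N `\` opt_set (phi N)) (r *: m)%R.
  by split=> // phi_rm; apply: nphi_rm; exact: phi_quot_proj.
have [Nm|Nr] := primeN _ _ r_hom m_hom rm_notin.
  by left; apply/(NKE).
right=> q'; have [m' <-] := gproj_surj q'.
by rewrite -GRing.linearZ; apply/(NKE); exact: Nr.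
Qed.
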